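(* Let $p\in\mathbb{N}$, let $F:\mathbb{R}^p\to\mathbb{R}^p$ be continuously differentiable and injective, and for each $x\in\mathbb{R}^p$ let $\mathcal{D}_x$ be a distribution over pairs of matrices $(\mathbf{S},\mathbf{W})$ with $\mathbf{S}\in\mathbb{R}^{p\times\tau}$, $\mathbf{W}\in\mathbb{R}^{p\times p}$. Assume: (1) (proper finite distribution) for every $x\in\mathbb{R}^p$ there exist $r\in\mathbb{N}$, $\pi_1,\dots,\pi_r>0$ with $\sum_{i=1}^r\pi_i=1$, and matrices $\{(\mathbf{S}_i(x),\mathbf{W}_i(x))\}_{i=1}^r$ such that $\mathbb{P}_{(\mathbf{S},\mathbf{W})\sim\mathcal{D}_x}[(\mathbf{S},\mathbf{W})=(\mathbf{S}_i(x),\mathbf{W}_i(x))]=\pi_i$ for $i=1,\dots,r$; (2) for every $x\in\mathbb{R}^p$, $\nabla F(x)^\top\nabla F(x)$ and $\mathbb{E}_{\mathcal{D}_x}[\mathbf{S}\mathbf{S}^\top]$ are invertible, and every $\mathbf{W}\sim\mathcal{D}_x$ is symmetric positive definite; (3) there exist a set $\Omega\subset\mathbb{R}^p$ and constants $\mu_W,L_W,\bar\mu_S,L_S,\mu_{\nabla F},L_{\nabla F}\in(0,+\infty)$ such that for all $x\in\Omega$ and all $(\mathbf{S},\mathbf{W})\sim\mathcal{D}_x$, $$\mathrm{spec}(\mathbf{W})\subset[\mu_W,L_W],\quad \sigma(\nabla F(x))\subset[\mu_{\nabla F},L_{\nabla F}],\quad \bar\mu_S\le\lambda_{\min}(\mathbb{E}_{\mathcal{D}_x}[\mathbf{S}\mathbf{S}^\top]),\quad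 \|\mathbf{S}\mathbf{S}^\top\|\le L_S.$$ Let $\gamma>0$, let $(x^k)_{k\in\mathbb{N}}$ be generated by the SNRVM algorithm with step size $\gamma$ (see context), with $\hat f_k(x)=\frac12\|F(x)\|^2_{(\nabla F(x^k)^\top\mathbf{W}_k^{-1}\nabla F(x^k))^\dagger}$, and assume: (4) there exists $L>0$ such that, for every $k\in\mathbb{N}$ and every $x\in\mathbb{R}^p$, $$\hat f_{k+1}(x)\le \hat f_k(x^k)+\langle\nabla\hat f_k(x^k),x-x^k\rangle+\tfrac{L}{2}\|x-x^k\|^2_{\mathbf{W}_k},$$ and $\gamma=1/L$. Suppose that $x^k\in\Omega$ for all $k$ almost surely. Then for all $k\in\mathbb{N}$, $$\mathbb{E}\left[\|F(x^k)\|^2\right]\le C(1-\gamma\rho)^k,\qquad \rho=\frac{\mu_{\nabla F}^2}{L_{\nabla F}^2}\,\frac{\mu_W}{L_W}\,\frac{\bar\mu_S}{L_S},\qquad C=2\,\mathbb{E}[\hat f_0(x^0)]\,\frac{L_{\nabla F}^2}{\mu_W}.$$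
   Context: Conventions: $\nabla F(x)\in\mathbb{R}^{p\times p}$ is the transpose of the usual Jacobian. $^\dagger$ is the Moore–Penrose pseudoinverse. For a symmetric positive semidefinite matrix $\mathbf{M}$, $\|v\|_{\mathbf{M}}^2=\langle \mathbf{M}v,v\rangle$. $\mathrm{spec}$ is the set of eigenvalues, $\sigma$ the set of singular values of a square matrix, $\lambda_{\min}$ the smallest eigenvalue, $\|\cdot\|$ the Euclidean/operator norm. ''For all $(\mathbf{S},\mathbf{W})\sim\mathcal{D}_x$'' means for all pairs in the finite support of $\mathcal{D}_x$. SNRVM (Sketched Newton Raphson with Variable Metric) with step size $\gamma>0$: from a given deterministic $x^0\in\mathbb{R}^p$, at each iteration $k$, conditionally on the past, sample $(\mathbf{S}_k,\mathbf{W}_k)\sim\mathcal{D}_{x^k}$ and set $$x^{k+1}=x^k-\gamma\mathbf{W}_k^{-1}\nabla F(x^k)\mathbf{S}_k\left(\mathbf{S}_k^\top\nabla F(x^k)^\top\mathbf{W}_k^{-1}\nabla F(x^k)\mathbf{S}_k\right)^\dagger\mathbf{S}_k^\top F(x^k).$$ In the definition of $\hat f_k$, $x^k$ and $\mathbf{W}_k$ are held fixed. Assumption (4) is required for every realization of the random choices of the run. *)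

(* Defs.v *)
From HB Require Import structures.
From mathcomp Require Import all_boot all_order all_algebra.
From mathcomp Require Import all_classical all_reals all_analysis.

Set Implicit Arguments.
Unset Strict Implicit.
Unset Printing Implicit Defensive.

Import Order.TTheory GRing.Theory Num.Theory.
Import numFieldNormedType.Exports.

Local Open Scope classical_set_scope.
Local Open Scope ring_scope.

Section LinearAlgebra.
Context {R : realType}.

Definition dot n (u v : 'cV[R]_n) : R := \sum_i u i 0 * v i 0.

(* The norm `|v| that MathComp-Analysis puts on matrices is the sup norm. *)
Definition enorm n (v : 'cV[R]_n) : R := Num.sqrt (dot v v).

(* |v|_M^2 = <M v, v> *)
Definition wnorm2 n (M : 'M[R]_n) (v : 'cV[R]_n) : R := dot (M *m v) v.

Definition opnorm m n (A : 'M[R]_(m, n)) : R :=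
  sup [set enorm (A *m v) | v in [set v : 'cV[R]_n | enorm v <= 1]].

Definition sym_posdef n (M : 'M[R]_n) : Prop :=
  M^T = M /\ forall v : 'cV[R]_n, v != 0 -> 0 < dot (M *m v) v.

(* Real eigenvalues only; below, spec and lambda_min are applied to symmetric
   matrices, all of whose eigenvalues are real. *)
Definition spec n (M : 'M[R]_n) : set R := [set a | eigenvalue M a].

(* Singular values: the nonnegative square roots of the eigenvalues of A^T A. *)
Definition singvals n (A : 'M[R]_n) : set R :=
  [set s | 0 <= s /\ eigenvalue (A^T *m A) (s ^+ 2)].

(* For symmetric M and 0 < n the infimum is attained, the set being finite and
   nonempty. *)
Definition lambda_min n (M : 'M[R]_n) : R := inf (spec M).

Definition is_pinv m n (A : 'M[R]_(m, n)) (B : 'M[R]_(n, m)) : Prop :=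
  [/\ A *m B *m A = A, B *m A *m B = B,
      (A *m B)^T = A *m B & (B *m A)^T = B *m A].

(* Moore-Penrose pseudoinverse; pinvP and is_pinv_uniq show that the default
   value of xget is never used and that the choice is unique. *)
Definition pinv m n (A : 'M[R]_(m, n)) : 'M[R]_(n, m) := xget 0 (is_pinv A).

Lemma is_pinv_uniq m n (A : 'M[R]_(m, n)) (B C : 'M[R]_(n, m)) :
  is_pinv A B -> is_pinv A C -> B = C.
Proof.
move=> [b1 b2 b3 b4] [c1 c2 c3 c4].
have AB : A *m B = A *m C.
  have e : A *m B = (A *m C) *m (A *m B) by rewrite mulmxA c1.
  by rewrite -b3 e trmx_mul b3 c3 mulmxA b1.
have BA : B *m A = C *m A.
  have e : B *m A = (B *m A) *m (C *m A) by rewrite -!mulmxA (mulmxA A) c1.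
  by rewrite -b4 e trmx_mul b4 c4 -!mulmxA (mulmxA A B A) b1.
by rewrite -b2 BA -mulmxA AB mulmxA c2.
Qed.

Lemma gram_unit m n (G : 'M[R]_(m, n)) : row_free G -> G *m G^T \in unitmx.
Proof.
move=> Gfree; rewrite -row_free_unit -kermx_eq0; apply/eqP/row_matrixP => i.
rewrite row0; set v := row i _.
have vG : v *m (G *m G^T) = 0 by rewrite -row_mul mulmx_ker row0.
have : (v *m G) *m (v *m G)^T = 0 by rewrite trmx_mul mulmxA -(mulmxA v) vG mul0mx.
move/matrixP/(_ 0 0); rewrite mxE [RHS]mxE => /eqP.
rewrite psumr_eq0; last by move=> j _; rewrite [_^T _ _]mxE -expr2 sqr_ge0.
move/allP => s0; apply: (row_free_inj Gfree); rewrite mul0mx.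
apply/rowP => j; have := s0 j (mem_index_enum _).
by rewrite [_^T _ _]mxE -expr2 sqrf_eq0 [RHS]mxE => /eqP.
Qed.

Lemma pinvP m n (A : 'M[R]_(m, n)) : is_pinv A (pinv A).
Proof.
suff [B AB] : exists B, is_pinv A B by apply: xgetPex; exists B.
have [r [C [G [AE fG fC]]]] : exists r (C : 'M[R]_(m, r)) (G : 'M[R]_(r, n)),
    [/\ A = C *m G, row_free G & row_free C^T].
  exists (\rank A), (col_base A), (row_base A).
  rewrite mulmx_base row_base_free; split=> //.
  by rewrite /row_free mxrank_tr; exact: col_base_full.
have uG := gram_unit fG; have uC := gram_unit fC; rewrite trmxK in uC.
have sG : (invmx (G *m G^T))^T = invmx (G *m G^T).
  by rewrite trmx_inv trmx_mul trmxK.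
have sC : (invmx (C^T *m C))^T = invmx (C^T *m C).
  by rewrite trmx_inv trmx_mul trmxK.
pose B := G^T *m invmx (G *m G^T) *m (invmx (C^T *m C) *m C^T).
have AB : A *m B = C *m (invmx (C^T *m C) *m C^T).
  by rewrite AE /B !mulmxA -(mulmxA C G) mulmxK.
have BA : B *m A = G^T *m invmx (G *m G^T) *m G.
  by rewrite AE /B -!mulmxA (mulmxA C^T C) mulKmx.
exists B; split.
- by rewrite AB AE -!mulmxA (mulmxA C^T C) mulKmx.
- by rewrite BA /B -!mulmxA (mulmxA G G^T) mulKVmx.
- by rewrite AB !trmx_mul trmxK sC mulmxA.
- by rewrite BA !trmx_mul trmxK sG mulmxA.
Qed.

End LinearAlgebra.

Section Calculus.
Context {R : realType}.

Definition grad p (f : 'cV[R]_p -> R) (x : 'cV[R]_p) : 'cV[R]_p :=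
  \col_i 'D_(delta_mx i 0) f x.

(* (nabla F x) i j = dF_j/dx_i, the transpose of the usual Jacobian *)
Definition nabla p (F : 'cV[R]_p -> 'cV[R]_p) (x : 'cV[R]_p) : 'M[R]_p :=
  \matrix_(i, j) 'D_(delta_mx i 0) (fun y => F y j 0) x.

Definition C1 p (F : 'cV[R]_p -> 'cV[R]_p) : Prop :=
  (forall x, differentiable F x) /\ continuous (nabla F).

End Calculus.

(* The pairs (S, W) of sketching and metric matrices, with the Borel
   sigma-algebra *)
Notation sketch R p tau :=
  (g_sigma_algebraType (@open ('M[R]_(p, tau) * 'M[R]_p)%type)).

Section Distributions.
Context {R : realType} {p tau : nat}.

(* The atoms are pairwise distinct; otherwise the weights summing to 1 would
   not exhaust the mass of mu. *)
Definition proper_finite (mu : probability (sketch R p tau) R) : Prop :=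
  exists (r : nat) (pi : 'I_r -> R) (SW : 'I_r -> sketch R p tau),
    [/\ injective SW, (forall i, 0 < pi i), \sum_i pi i = 1
      & forall i, mu [set SW i] = (pi i)%:E].

(* For a finite distribution, the support is the set of its atoms. *)
Definition supp (mu : probability (sketch R p tau) R) : set (sketch R p tau) :=
  [set z | (0 < mu [set z])%E].

Definition mean_SST (mu : probability (sketch R p tau) R) : 'M[R]_p :=
  \matrix_(i, j)
    fine ('E_mu[fun z : sketch R p tau => (z.1 *m z.1^T) i j])%E.

End Distributions.

Section SNRVM.
Context {R : realType} {p tau : nat}.

(* hat f_k with x^k = xk and W_k = Wk held fixed *)
Definition fhat (F : 'cV[R]_p -> 'cV[R]_p) (xk : 'cV[R]_p) (Wk : 'M[R]_p)
    (x : 'cV[R]_p) : R :=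
  2^-1 * wnorm2 (pinv ((nabla F xk)^T *m invmx Wk *m nabla F xk)) (F x).

Definition snrvm_step (F : 'cV[R]_p -> 'cV[R]_p) (gamma : R)
    (SW : sketch R p tau) (x : 'cV[R]_p) : 'cV[R]_p :=
  let S := SW.1 in let W := SW.2 in let N := nabla F x in
  x - gamma *: (invmx W *m N *m S
                *m pinv (S^T *m N^T *m invmx W *m N *m S) *m S^T *m F x).

(* The k-th iterate as a function of the draws; only the draws h j with j < k
   matter. *)
Fixpoint snrvm (F : 'cV[R]_p -> 'cV[R]_p) (gamma : R) (x0 : 'cV[R]_p)
    (h : nat -> sketch R p tau) (k : nat) : 'cV[R]_p :=
  if k is k'.+1 then snrvm_step F gamma (h k') (snrvm F gamma x0 h k') else x0.

(* Conditionally on the first k draws, the draw SW k has law D_{x^k}. The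
   conditioning is elementary, on each possible value h of the past draws: when
   every D x is finite, these events carry all the mass. *)
Definition snrvm_sampling d (T : measurableType d) (P : probability T R)
    (F : 'cV[R]_p -> 'cV[R]_p)
    (D : 'cV[R]_p -> probability (sketch R p tau) R)
    (gamma : R) (x0 : 'cV[R]_p) (SW : nat -> {mfun T >-> sketch R p tau}) :=
  forall (k : nat) (h : nat -> sketch R p tau) (A : set (sketch R p tau)),
    measurable A ->
    let past := [set w | forall j, (j < k)%N -> SW j w = h j] in
    P (past `&` SW k @^-1` A) = (P past * D (snrvm F gamma x0 h k) A)%E.

End SNRVM.

(* Main.v *)
(** Write N for nabla F(x^k), f for F(x^k), M = N^T W_k^-1 N, H = S_k^T M S_k
    and q = <H^+ S_k^T f, S_k^T f>.  The step x^{k+1} - x^k minimises the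
    quadratic model of assumption (4) along the range of W_k^-1 N S_k, and
    with gamma = 1/L the model drops by exactly gamma q / 2.  Since
    S_k^T f = H y is solvable, |S_k^T f|^2 = |S_k^T M S_k y|^2 is at most
    L_S (L_F^2 / mu_W) <M S_k y, S_k y> = L_S (L_F^2 / mu_W) q; averaging over
    the draw, E[q | past] >= mu_S mu_W / (L_S L_F^2) |f|^2, and
    hat f_k(x^k) <= (L_W / mu_F^2) |f|^2 / 2, so E[hat f_k(x^k)] contracts by
    1 - gamma rho.

    All distributions being finite, the first k draws take almost surely
    finitely many values, and every expectation is a finite sum.  This avoids
    the measurability of the pseudoinverse: a function that agrees off a null
    set with a simple function has the same integral, measurable or not. *)

Require Import Defs.
From HB Require Import structures.
From mathcomp Require Import all_boot all_order all_algebra.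
From mathcomp Require Import all_classical all_reals all_analysis.
From mathcomp Require Import measurable_realfun ring lra.

Set Implicit Arguments.
Unset Strict Implicit.
Unset Printing Implicit Defensive.

Import Order.TTheory GRing.Theory Num.Theory.
Import numFieldNormedType.Exports.

Local Open Scope classical_set_scope.
Local Open Scope ring_scope.

(** * Quadratic forms *)

Section DotProduct.
Context {R : realType}.

Lemma dotE n (u v : 'cV[R]_n) : dot u v = (u^T *m v) 0 0.
Proof. by rewrite mxE; apply: eq_bigr => i _; rewrite mxE. Qed.

Lemma dotC n (u v : 'cV[R]_n) : dot u v = dot v u.
Proof. by apply: eq_bigr => i _; rewrite mulrC. Qed.

Lemma dotDl n (u v w : 'cV[R]_n) : dot (u + v) w = dot u w + dot v w.
Proof. by rewrite -big_split; apply: eq_bigr => i _; rewrite mxE mulrDl. Qed.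

Lemma dotZl n a (u v : 'cV[R]_n) : dot (a *: u) v = a * dot u v.
Proof. by rewrite mulr_sumr; apply: eq_bigr => i _; rewrite mxE mulrA. Qed.

Lemma dotNl n (u v : 'cV[R]_n) : dot (- u) v = - dot u v.
Proof. by rewrite -scaleN1r dotZl mulN1r. Qed.

Lemma dotBl n (u v w : 'cV[R]_n) : dot (u - v) w = dot u w - dot v w.
Proof. by rewrite dotDl dotNl. Qed.

Lemma dotDr n (u v w : 'cV[R]_n) : dot w (u + v) = dot w u + dot w v.
Proof. by rewrite dotC dotDl !(dotC w). Qed.

Lemma dotZr n a (u v : 'cV[R]_n) : dot u (a *: v) = a * dot u v.
Proof. by rewrite dotC dotZl dotC. Qed.

Lemma dotNr n (u v : 'cV[R]_n) : dot u (- v) = - dot u v.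
Proof. by rewrite dotC dotNl dotC. Qed.

Lemma dotBr n (u v w : 'cV[R]_n) : dot w (u - v) = dot w u - dot w v.
Proof. by rewrite dotDr dotNr. Qed.

Lemma dot0l n (v : 'cV[R]_n) : dot 0 v = 0.
Proof. by rewrite -(scale0r 0) dotZl mul0r. Qed.

Lemma dot0r n (v : 'cV[R]_n) : dot v 0 = 0.
Proof. by rewrite dotC dot0l. Qed.

Lemma dot_mulmx m n (A : 'M[R]_(m, n)) u v : dot (A *m u) v = dot u (A^T *m v).
Proof. by rewrite !dotE trmx_mul mulmxA. Qed.

Lemma dot_ge0 n (v : 'cV[R]_n) : 0 <= dot v v.
Proof. by apply: sumr_ge0 => i _; rewrite -expr2 sqr_ge0. Qed.

Lemma dot_eq0 n (v : 'cV[R]_n) : dot v v = 0 -> v = 0.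
Proof.
move/eqP; rewrite psumr_eq0 => [|i _]; last by rewrite -expr2 sqr_ge0.
move/allP => v0; apply/colP => i; have := v0 i (mem_index_enum _).
by rewrite -expr2 sqrf_eq0 mxE => /eqP.
Qed.

Lemma dot_gt0 n (v : 'cV[R]_n) : v != 0 -> 0 < dot v v.
Proof.
by move=> v0; rewrite lt0r dot_ge0 andbT; apply: contraNneq v0 => /dot_eq0 ->.
Qed.

(** The form at t u + s v is nonnegative. Taking t = -b and s = a gives a (a c - b^2) >= 0, which
    settles the case a > 0. *)
Lemma CauchySchwarz_form n (B : 'M[R]_n) (u v : 'cV[R]_n) :
  B^T = B -> (forall w, 0 <= dot (B *m w) w) ->
  dot (B *m u) v ^+ 2 <= dot (B *m u) u * dot (B *m v) v.
Proof.
move=> sB B0; set a := dot (B *m u) u; set b := dot (B *m u) v.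
set c := dot (B *m v) v.
have E t s : 0 <= t ^+ 2 * a + 2 * t * s * b + s ^+ 2 * c.
  have := B0 (t *: u + s *: v).
  rewrite mulmxDr -!scalemxAr !(dotDl, dotDr, dotZl, dotZr).
  rewrite (dot_mulmx B v u) sB (dotC v) -/a -/b -/c => H.
  by apply: le_trans H _; rewrite le_eqVlt; apply/orP; left; apply/eqP; ring.
have [a0|a0] := leP a 0.
  have {a0}a0 : a = 0 by apply/eqP; rewrite eq_le a0 /=; exact: B0.
  (* When a = 0, this choice turns the form into -(c + 2) b^2, which forces b = 0. *)
  have := E (- (c + 1)) b; have c0 : 0 <= c by exact: B0.
  rewrite a0 mul0r mulr0 add0r => H; have b2 := sqr_ge0 b.
  have {H}: 0 <= - ((c + 2) * b ^+ 2) by lra.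
  nra.
have := E (- b) a; have -> : (- b) ^+ 2 * a + 2 * - b * a * b + a ^+ 2 * c
  = a * (a * c - b ^+ 2) by ring.
by rewrite pmulr_rge0 // subr_ge0.
Qed.

Lemma CauchySchwarz_dot n (u v : 'cV[R]_n) : dot u v ^+ 2 <= dot u u * dot v v.
Proof.
have := @CauchySchwarz_form n 1%:M u v (trmx1 _ _); rewrite !mul1mx; apply => w.
by rewrite mul1mx dot_ge0.
Qed.

Lemma enorm_ge0 n (v : 'cV[R]_n) : 0 <= enorm v.
Proof. exact: sqrtr_ge0. Qed.

Lemma enorm_sqr n (v : 'cV[R]_n) : enorm v ^+ 2 = dot v v.
Proof. by rewrite sqr_sqrtr ?dot_ge0. Qed.

(** The squared Frobenius norm, used wherever some finite bound on A is enough. *)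
Definition frob2 m n (A : 'M[R]_(m, n)) : R := \sum_i \sum_j A i j ^+ 2.

Lemma frob2_ge0 m n (A : 'M[R]_(m, n)) : 0 <= frob2 A.
Proof. by apply: sumr_ge0 => i _; apply: sumr_ge0 => j _; rewrite sqr_ge0. Qed.

Lemma dot_mulmx_frob2 m n (A : 'M[R]_(m, n)) v :
  dot (A *m v) (A *m v) <= frob2 A * dot v v.
Proof.
rewrite /frob2 mulr_suml; apply: ler_sum => i _.
have -> : (A *m v) i 0 = dot (row i A)^T v.
  by rewrite mxE; apply: eq_bigr => j _; rewrite !mxE.
rewrite -expr2 (le_trans (CauchySchwarz_dot _ _)) // ler_wpM2r ?dot_ge0 //.
by apply: ler_sum => j _; rewrite !mxE expr2.
Qed.

(** Expanding |A v + v|^2 >= 0 and |A v - v|^2 >= 0 bounds 2 |<A v, v>| by |A v|^2 + |v|^2. *)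
Lemma form_frob2 n (A : 'M[R]_n) v :
  `|dot (A *m v) v| <= (frob2 A + 1) / 2 * dot v v.
Proof.
have H := dot_mulmx_frob2 A v; rewrite ler_norml; apply/andP; split.
  have := dot_ge0 (A *m v + v); rewrite !(dotDl, dotDr) (dotC v); lra.
have := dot_ge0 (A *m v - v); rewrite !(dotDl, dotDr, dotNl, dotNr) (dotC v).
lra.
Qed.

End DotProduct.

(** * Extreme eigenvalues and bounds on quadratic forms *)

Section Rayleigh.
Context {R : realType}.

(* |v|^4 = <B (B^-1 v), v>^2 <= <v, B^-1 v> <B v, v> by Cauchy-Schwarz for the
   form B *)
Lemma psd_unit_lb n (B : 'M[R]_n) :
  B^T = B -> (forall v, 0 <= dot (B *m v) v) -> B \in unitmx ->
  exists2 e : R, 0 < e & forall v, e * dot v v <= dot (B *m v) v.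
Proof.
move=> sB B0 uB; set c := (frob2 (invmx B) + 1) / 2.
have c0 : 0 < c by have := frob2_ge0 (invmx B); rewrite /c; lra.
exists c^-1; first by rewrite invr_gt0.
move=> v; have [->|v0] := eqVneq v 0; first by rewrite mulmx0 !dot0r mulr0.
have := CauchySchwarz_form (invmx B *m v) v sB B0.
rewrite mulmxA mulmxV // mul1mx => H.
have := form_frob2 (invmx B) v; rewrite -/c ler_norml dotC => /andP[_ H2].
have p0 := dot_gt0 v0; have q0 := B0 v.
rewrite mulrC ler_pdivrMr //.
have : dot v v ^+ 2 <= dot v v * (dot (B *m v) v * c) by nra.
by rewrite expr2 ler_pM2l.
Qed.

Lemma not_unit_eigenvalue n (A : 'M[R]_n) a :
  A - a%:M \notin unitmx -> eigenvalue A a.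
Proof. by rewrite /eigenvalue /eigenspace kermx_eq0 row_free_unit. Qed.

(* The largest a with A - a PSD is an eigenvalue: otherwise A - a would be
   bounded below by some e > 0. *)
Lemma eigenvalue_form_lb n (A : 'M[R]_n) : (0 < n)%N -> A^T = A ->
  exists2 a, eigenvalue A a & forall v, a * dot v v <= dot (A *m v) v.
Proof.
case: n A => // n A _ sA.
pose E := [set t : R | forall v, t * dot v v <= dot (A *m v) v].
pose e0 : 'cV[R]_n.+1 := delta_mx 0 0.
have e0_neq0 : e0 != 0.
  by apply/eqP => /matrixP/(_ 0 0); rewrite !mxE eqxx => /eqP; rewrite oner_eq0.
have ubE v : v != 0 -> ubound E (dot (A *m v) v / dot v v).
  by move=> v0 t Et; rewrite ler_pdivlMr ?dot_gt0.
have supE : has_sup E.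
  split; last first.
    by exists (dot (A *m e0) e0 / dot e0 e0); exact: ubE.
  exists (- ((frob2 A + 1) / 2)) => v.
  by have := form_frob2 A v; rewrite ler_norml mulNr => /andP[].
have aE : E (sup E).
  move=> v; have [->|v0] := eqVneq v 0; first by rewrite mulmx0 !dot0r mulr0.
  by rewrite -ler_pdivlMr ?dot_gt0 //; apply: ge_sup; [case: supE|exact: ubE].
exists (sup E) => //; apply: not_unit_eigenvalue; apply/negP => uB.
have BE v : dot ((A - (sup E)%:M) *m v) v = dot (A *m v) v - sup E * dot v v.
  by rewrite mulmxBl dotBl mul_scalar_mx dotZl.
have [| |e e_gt0 eB] := psd_unit_lb _ _ uB.
- by rewrite linearB /= sA tr_scalar_mx.
- by move=> v; rewrite BE subr_ge0; exact: aE.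
suff : sup E + e <= sup E by lra.
apply: sup_upper_bound => // v.
by have := eB v; rewrite BE mulrDl; lra.
Qed.

Lemma eigenvalueN n (A : 'M[R]_n) a : eigenvalue (- A) a -> eigenvalue A (- a).
Proof.
case/eigenvalueP => v vA v0; apply/eigenvalueP; exists v => //.
by rewrite scaleNr -vA mulmxN opprK.
Qed.

Lemma eigenvalue_form_ub n (A : 'M[R]_n) : (0 < n)%N -> A^T = A ->
  exists2 b, eigenvalue A b & forall v, dot (A *m v) v <= b * dot v v.
Proof.
move=> n0 sA; have [|a aA H] := @eigenvalue_form_lb n (- A) n0.
  by rewrite linearN /= sA.
exists (- a); first exact: eigenvalueN.
by move=> v; have := H v; rewrite mulNmx dotNl; lra.
Qed.

Lemma eigenvalue_form n (A : 'M[R]_n) a : A^T = A -> eigenvalue A a ->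
  exists2 v : 'cV[R]_n, v != 0 & dot (A *m v) v = a * dot v v.
Proof.
move=> sA /eigenvalueP[v vA v0]; exists v^T; first by rewrite trmx_eq0.
by rewrite -dotZl; congr dot; rewrite -{1}sA -trmx_mul vA linearZ.
Qed.

Lemma spec_bounds n (A : 'M[R]_n) (m M : R) : A^T = A ->
  spec A `<=` `[m, M]%classic ->
  forall v, m * dot v v <= dot (A *m v) v <= M * dot v v.
Proof.
(* In dimension 0 the spectrum is empty and gives no information, but v = 0. *)
case: n A => [A _ _ v|n A sA AmM v].
  by rewrite (_ : v = 0) ?mulmx0 ?dot0r ?mulr0 ?lexx //; apply/colP => -[].
have [a /AmM + aA] := eigenvalue_form_lb (ltn0Sn n) sA.
have [b /AmM + bA] := eigenvalue_form_ub (ltn0Sn n) sA.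
rewrite /= !in_itv /= => /andP[_ bM] /andP[ma _].
apply/andP; split; [apply: le_trans (aA v)|apply: le_trans (bA v) _].
all: by rewrite ler_wpM2r ?dot_ge0.
Qed.

Lemma lambda_min_form n (A : 'M[R]_n) : A^T = A ->
  forall v, lambda_min A * dot v v <= dot (A *m v) v.
Proof.
case: n A => [A _ v|n A sA v].
  by rewrite (_ : v = 0) ?mulmx0 ?dot0r ?mulr0 ?lexx //; apply/colP => -[].
have [a aS aA] := eigenvalue_form_lb (ltn0Sn n) sA.
apply: le_trans (aA v); rewrite ler_wpM2r ?dot_ge0 //.
(* For [inf] to be a genuine lower bound the spectrum must be bounded below; the form bound at an
   eigenvector shows that [a] bounds it. *)
apply: ge_inf => //; exists a => b /(eigenvalue_form sA)[w w0 wb].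
by rewrite -(ler_pM2r (dot_gt0 w0)) -wb.
Qed.

(** Every eigenvalue of N^T N is nonnegative, hence the square of a singular value, so [spec_bounds]
    applies to N^T N. *)
Lemma singvals_bounds n (N : 'M[R]_n) (m M : R) : 0 < m ->
  singvals N `<=` `[m, M]%classic ->
  forall v, m ^+ 2 * dot v v <= dot (N *m v) (N *m v) <= M ^+ 2 * dot v v.
Proof.
move=> m0 NmM v; have sN : (N^T *m N)^T = N^T *m N by rewrite trmx_mul trmxK.
have NE w : dot (N *m w) (N *m w) = dot (N^T *m N *m w) w.
  by rewrite -mulmxA dot_mulmx dotC.
rewrite NE; apply: spec_bounds => // a aN.
have [w w0 aw] := eigenvalue_form sN aN.
have a0 : 0 <= a by rewrite -(pmulr_lge0 _ (dot_gt0 w0)) -aw -NE dot_ge0.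
have /NmM : singvals N (Num.sqrt a).
  by split; rewrite ?sqrtr_ge0 // sqr_sqrtr.
rewrite /= !in_itv /= => /andP[ma aM].
move: (sqr_sqrtr a0) ma aM (sqrtr_ge0 a); set s := Num.sqrt a => <- ms sM s0.
rewrite !lerXn2r ?nnegrE ?(ltW m0) //.
exact: le_trans sM.
Qed.

Lemma opnorm_form n (A : 'M[R]_n) v : dot (A *m v) v <= opnorm A * dot v v.
Proof.
have [->|v0] := eqVneq v 0; first by rewrite mulmx0 !dot0r mulr0.
have nv0 : 0 < enorm v by rewrite sqrtr_gt0 dot_gt0.
have scaleE m (u : 'cV[R]_m) a : 0 <= a -> enorm (a *: u) = a * enorm u.
  move=> a0; rewrite /enorm dotZl dotZr mulrA sqrtrM ?mulr_ge0 //.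
  by rewrite -expr2 sqrtr_sqr ger0_norm.
have sA : enorm (A *m v) <= opnorm A * enorm v.
  rewrite -ler_pdivrMr // mulrC -scaleE ?invr_ge0 ?enorm_ge0 // scalemxAr.
  apply: ub_le_sup; last first.
    exists ((enorm v)^-1 *: v) => //=.
    by rewrite scaleE ?invr_ge0 ?enorm_ge0 // mulVf ?gt_eqF.
  (* The supremum defining [opnorm] is over a bounded set, so it is not a default value. *)
  exists (Num.sqrt (frob2 A)) => _ [u /= u1 <-].
  apply: ler_wsqrtr; apply: le_trans (dot_mulmx_frob2 _ _) _.
  rewrite -[leRHS]mulr1 ler_wpM2l ?frob2_ge0 // -enorm_sqr.
  by rewrite expr_le1 ?enorm_ge0.
have CS : dot (A *m v) v <= enorm (A *m v) * enorm v.
  have := CauchySchwarz_dot (A *m v) v.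
  rewrite -!enorm_sqr -exprMn => /ler_wsqrtr; rewrite !sqrtr_sqr.
  rewrite (ger0_norm (mulr_ge0 _ _)) ?enorm_ge0 //.
  by apply: le_trans; exact: ler_norm.
apply: le_trans CS _; rewrite -enorm_sqr expr2 mulrA.
by rewrite ler_wpM2r ?enorm_ge0.
Qed.

End Rayleigh.

(** * The sketched Newton step *)

Section Pseudoinverse.
Context {R : realType}.

Lemma pinv_unit n (A : 'M[R]_n) : A \in unitmx -> Defs.pinv A = invmx A.
Proof.
move=> uA; apply: is_pinv_uniq (pinvP A) _; split.
- by rewrite mulmxV // mul1mx.
- by rewrite mulVmx // mul1mx.
- by rewrite mulmxV // trmx1.
- by rewrite mulVmx // trmx1.
Qed.

(** For symmetric A, transposing the four Penrose equations shows that the transpose is again a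
    pseudoinverse of A; uniqueness concludes. *)
Lemma pinv_sym n (A : 'M[R]_n) : A^T = A -> (Defs.pinv A)^T = Defs.pinv A.
Proof.
move=> sA; apply: is_pinv_uniq (pinvP A); have [p1 p2 p3 p4] := pinvP A.
split.
- by rewrite -[RHS]sA -[in RHS]p1 !trmx_mul sA mulmxA.
- by rewrite -[in RHS]p2 !trmx_mul sA mulmxA.
- by rewrite trmx_mul trmxK sA -[LHS]p4 trmx_mul sA.
- by rewrite trmx_mul trmxK sA -[LHS]p3 trmx_mul sA.
Qed.

Lemma mulmx_pinv_ker m n (A : 'M[R]_(m, n)) (v : 'cV[R]_n) :
  A *m (v - Defs.pinv A *m (A *m v)) = 0.
Proof. by have [p1 _ _ _] := pinvP A; rewrite mulmxBr !mulmxA p1 subrr. Qed.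

Lemma sym_posdef_unit n (W : 'M[R]_n) : sym_posdef W -> W \in unitmx.
Proof.
case=> sW pW; rewrite -row_free_unit -kermx_eq0; apply/eqP/row_matrixP => i.
rewrite row0; apply/eqP/negPn/negP => v0.
have := pW (row i (kermx W))^T; rewrite trmx_eq0 v0 => /(_ isT).
by rewrite -{1}sW -trmx_mul -row_mul mulmx_ker row0 trmx0 dot0l ltxx.
Qed.

End Pseudoinverse.

Lemma mulmxA4 (R : pzRingType) m1 m2 m3 m4 m5 (A : 'M[R]_(m1, m2))
    (B : 'M[R]_(m2, m3)) (C : 'M[R]_(m3, m4)) (D : 'M[R]_(m4, m5)) :
  A *m B *m C *m D = A *m (B *m (C *m D)).
Proof. by rewrite -!mulmxA. Qed.

(** * The matrix M = N^T W^-1 N and its sketches *)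

Section Metric.
Context {R : realType} {p : nat}.
Implicit Types (N W : 'M[R]_p) (f z : 'cV[R]_p).

Definition metric N W : 'M[R]_p := N^T *m invmx W *m N.

(** The quantity q of the overview: the quadratic model drops by gamma / 2 times it. *)
Definition sketch_gain tau N W (S : 'M[R]_(p, tau)) f : R :=
  dot (Defs.pinv (S^T *m metric N W *m S) *m (S^T *m f)) (S^T *m f).

Lemma metric_sym N W : W^T = W -> (metric N W)^T = metric N W.
Proof. by move=> sW; rewrite /metric !trmx_mul trmxK trmx_inv sW mulmxA. Qed.

Lemma metric_unit N W : W \in unitmx -> N \in unitmx -> metric N W \in unitmx.
Proof. by move=> uW uN; rewrite !unitmx_mul unitmx_tr unitmx_inv uN uW. Qed.

(** Passing to u trades the form of W^-1 for that of W, so that bounds on the spectrum of W apply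
    directly. *)
Lemma metric_form N W z : W^T = W -> W \in unitmx ->
  let u := invmx W *m (N *m z) in dot (metric N W *m z) z = dot (W *m u) u.
Proof.
move=> sW uW u; rewrite /metric -!mulmxA -/u dot_mulmx trmxK dotC.
by rewrite /u mulKVmx.
Qed.

Lemma metric_gt0 N W z : sym_posdef W -> N \in unitmx -> z != 0 ->
  0 < dot (metric N W *m z) z.
Proof.
move=> pW uN z0; have uW := sym_posdef_unit pW.
rewrite metric_form //; last by case: pW.
case: pW => _; apply; apply: contra_neq z0 => e.
by rewrite -(mulKmx uN z) -(mulKVmx uW (N *m z)) e !mulmx0.
Qed.

Lemma invmetric_form N W f : W \in unitmx -> N \in unitmx ->
  dot (invmx (metric N W) *m f) f
  = dot (metric N W *m (invmx (metric N W) *m f)) (invmx (metric N W) *m f).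
Proof. by move=> uW uN; rewrite mulKVmx ?metric_unit // dotC. Qed.

Lemma invmx_metric N W : W \in unitmx -> N \in unitmx ->
  invmx (metric N W) = invmx N *m W *m (invmx N)^T.
Proof.
move=> uW uN; apply: (can_inj (mulKmx (metric_unit uW uN))).
rewrite mulmxV ?metric_unit // /metric !mulmxA mulmxK // mulmxKV //.
by rewrite trmx_inv mulmxV // unitmx_tr.
Qed.

(* H = S^T M S satisfies H H^+ S^T = S^T because M is definite, so y = H^+ S^T f
   solves H y = S^T f *)
Lemma sketch_solve tau N W (S : 'M[R]_(p, tau)) f :
  sym_posdef W -> N \in unitmx ->
  let H := S^T *m metric N W *m S in
  H *m (Defs.pinv H *m (S^T *m f)) = S^T *m f.
Proof.
move=> pW uN H; have sM : (metric N W)^T = metric N W.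
  by apply: metric_sym; case: pW.
have sH : H^T = H by rewrite /H trmx_mul (trmx_mul S^T) trmxK sM mulmxA.
(* For q in the kernel of H, <M S q, S q> = <H q, q> = 0, so S q = 0. *)
have SQ (v : 'cV_tau) : S *m (v - Defs.pinv H *m (H *m v)) = 0.
  set q := v - _; apply/eqP; apply: contraTT isT => Sq0.
  have := metric_gt0 pW uN Sq0.
  have HqE : S^T *m (metric N W *m (S *m q)) = H *m q.
    by rewrite -mulmxA4.
  by rewrite dotC dot_mulmx HqE mulmx_pinv_ker dot0r ltxx.
(* Moving all factors to the right gives <r, r> = <f, S (r - H^+ H r)>, which vanishes by [SQ]. *)
apply/esym/eqP; rewrite -subr_eq0; apply/eqP/dot_eq0; set r := _ - _.
rewrite {1}/r dotBl !dot_mulmx trmxK pinv_sym // sH -dotBr -mulmxBr.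
by rewrite SQ dot0r.
Qed.

Lemma sketch_gain_solve tau N W (S : 'M[R]_(p, tau)) f :
  sym_posdef W -> N \in unitmx ->
  let y := Defs.pinv (S^T *m metric N W *m S) *m (S^T *m f) in
  sketch_gain N W S f = dot (metric N W *m (S *m y)) (S *m y).
Proof.
move=> pW uN y; rewrite /sketch_gain -/y dotC -(sketch_solve S f pW uN) -/y.
by rewrite mulmxA4 [LHS]dot_mulmx trmxK.
Qed.

Lemma sketch_gain_lb tau N W (S : 'M[R]_(p, tau)) f lam sig :
  sym_posdef W -> N \in unitmx -> 0 <= sig ->
  (forall z, dot (metric N W *m z) (metric N W *m z)
             <= lam * dot (metric N W *m z) z) ->
  (forall z, dot (S *m S^T *m z) z <= sig * dot z z) ->
  dot (S^T *m f) (S^T *m f) <= sig * lam * sketch_gain N W S f.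
Proof.
move=> pW uN sig0 Mlam Ssig; rewrite sketch_gain_solve //.
rewrite -{1 2}(sketch_solve S f pW uN); set y := Defs.pinv _ *m _.
rewrite mulmxA4; set z := metric N W *m _.
rewrite dot_mulmx trmxK dotC mulmxA.
by apply: le_trans (Ssig _) _; rewrite -mulrA ler_wpM2l //; apply: Mlam.
Qed.

(** N and N^T have the same singular values; Cauchy-Schwarz suffices here. Below: with v = N u,
    |v|^4 = <u, N^T v>^2 <= |u|^2 |N^T v|^2. Above: |N^T v|^4 = <N N^T v, v>^2 <= |N N^T v|^2
    |v|^2. *)
Lemma nabla_tr_bounds N (m M : R) : 0 < m -> N \in unitmx ->
  (forall v, m ^+ 2 * dot v v <= dot (N *m v) (N *m v) <= M ^+ 2 * dot v v) ->
  forall v, m ^+ 2 * dot v v <= dot (N^T *m v) (N^T *m v) <= M ^+ 2 * dot v v.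
Proof.
move=> m0 uN NmM v.
have [->|v0] := eqVneq v 0; first by rewrite mulmx0 !dot0r !mulr0 lexx.
have v_gt0 := dot_gt0 v0; apply/andP; split.
  have [u vE] : exists u, v = N *m u by exists (invmx N *m v); rewrite mulKVmx.
  have /andP[lb _] := NmM u; rewrite -vE in lb.
  have CS := CauchySchwarz_dot u (N^T *m v).
  rewrite dotC dot_mulmx trmxK -vE in CS.
  have w0 := dot_ge0 (N^T *m v); have m2 : 0 < m ^+ 2 by rewrite exprn_gt0.
  rewrite -(ler_pM2l v_gt0).
  nra.
have /andP[_ ub] := NmM (N^T *m v).
have CS := CauchySchwarz_dot (N *m (N^T *m v)) v.
rewrite dot_mulmx in CS.
set w := dot (N^T *m v) _ in ub CS *; have w0 : 0 <= w by exact: dot_ge0.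
have [->|w_neq0] := eqVneq w 0; first by rewrite mulr_ge0 ?sqr_ge0 ?ltW.
have w_gt0 : 0 < w by rewrite lt0r w_neq0.
by rewrite -(ler_pM2l w_gt0); nra.
Qed.

Section Bounds.
Context (N W : 'M[R]_p) (mW LW mF LF : R).
Hypotheses (mW_gt0 : 0 < mW) (LW_gt0 : 0 < LW) (mF_gt0 : 0 < mF).
Hypotheses (pW : sym_posdef W) (uN : N \in unitmx).
Hypothesis W_bounds : forall v, mW * dot v v <= dot (W *m v) v <= LW * dot v v.
Hypothesis N_bounds : forall v,
  mF ^+ 2 * dot v v <= dot (N^T *m v) (N^T *m v) <= LF ^+ 2 * dot v v.

(** With u = W^-1 N z, |M z|^2 = |N^T u|^2 <= LF^2 |u|^2, and mW |u|^2 <= <W u, u> = <M z, z>. *)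
Lemma metric_norm_ub z : dot (metric N W *m z) (metric N W *m z)
  <= LF ^+ 2 / mW * dot (metric N W *m z) z.
Proof.
rewrite metric_form ?sym_posdef_unit //; last by case: pW.
rewrite /metric -!mulmxA; set u := invmx W *m _.
have /andP[_] := N_bounds u; have /andP[+ _] := W_bounds u => Wu Nu.
apply: le_trans Nu _; rewrite -mulrA ler_wpM2l ?sqr_ge0 //.
by rewrite ler_pdivlMl.
Qed.

Lemma invmetric_lb f :
  dot f f <= LF ^+ 2 / mW * dot (invmx (metric N W) *m f) f.
Proof.
have uW := sym_posdef_unit pW; rewrite invmetric_form //.
have := metric_norm_ub (invmx (metric N W) *m f).
by rewrite mulKVmx ?metric_unit.
Qed.

(** With u = N^-T f the form of M^-1 at f is <W u, u> <= LW |u|^2, and mF^2 |u|^2 <= |N^T u|^2 =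
    |f|^2. *)
Lemma invmetric_ub f :
  dot (invmx (metric N W) *m f) f <= LW / mF ^+ 2 * dot f f.
Proof.
have uW := sym_posdef_unit pW; rewrite invmx_metric //.
rewrite -!mulmxA dot_mulmx; set u := (invmx N)^T *m f.
have /andP[_] := W_bounds u; have /andP[+ _] := N_bounds u => Nu Wu.
apply: le_trans Wu _; rewrite -mulrA ler_wpM2l ?(ltW LW_gt0) //.
rewrite ler_pdivlMl ?exprn_gt0 //.
by move: Nu; rewrite /u trmx_inv mulKVmx ?unitmx_tr.
Qed.

End Bounds.
End Metric.

(** * Gradient of the local model and its decrease along a step *)

Section Descent.
Context {R : realType} {p tau : nat}.
Variables (F : 'cV[R]_p -> 'cV[R]_p) (F_diff : forall x, differentiable F x).

Lemma derivable_coord x v i : derivable (fun y => F y i 0) x v.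
Proof. by apply: (derivable_mxP F x v).1; exact: diff_derivable. Qed.

(** The product rule yields two sums, equal because G is symmetric; hence the factor 2. *)
Lemma is_derive_form (G : 'M[R]_p) x v : G^T = G ->
  is_derive x v (fun y => dot (G *m F y) (F y))
    (2 * \sum_i (G *m F x) i 0 * 'D_v (fun y => F y i 0) x).
Proof.
move=> sG; pose h i y := F y i 0; pose dh i := 'D_v (h i) x.
have dhP i : is_derive x v (h i) (dh i).
  exact/derivableP/derivable_coord.
(* As a sum of products of coordinate functions, the form has a derivative that [is_derive_eq]
   infers from [dhP]. *)
rewrite (_ : (fun y => _) = \sum_i (\sum_j G i j *: h j) * h i); last first.
  apply/funext => y; rewrite fct_sumE; apply: eq_bigr => i _.
  rewrite mxE /= fctE fct_sumE; congr (_ * _).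
apply: is_derive_eq.
rewrite big_split /=; pose d := \col_i dh i.
have -> : \sum_i h i x *: \sum_j G i j *: dh j = dot (G *m F x) d.
  rewrite dot_mulmx sG; apply: eq_bigr => i _; rewrite mxE; congr (_ * _).
  by apply: eq_bigr => j _; rewrite mxE.
have -> : \sum_i (\sum_j G i j *: h j) x *: dh i = dot (G *m F x) d.
  apply: eq_bigr => i _; rewrite !mxE fct_sumE; congr (_ * _).
have -> : \sum_i (G *m F x) i 0 * 'D_v (fun y => F y i 0) x = dot (G *m F x) d.
  by apply: eq_bigr => i _; rewrite [d _ _]mxE.
by rewrite mulr_natl mulr2n.
Qed.

Lemma fhatE x W y : nabla F x \in unitmx -> sym_posdef W ->
  fhat F x W y = 2^-1 * dot (invmx (metric (nabla F x) W) *m F y) (F y).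
Proof.
move=> uN pW.
by rewrite /fhat pinv_unit // -/(metric _ _) metric_unit // sym_posdef_unit.
Qed.

Lemma grad_fhat x W y : nabla F x \in unitmx -> sym_posdef W ->
  grad (fhat F x W) y
  = nabla F y *m (invmx (metric (nabla F x) W) *m F y).
Proof.
move=> uN pW; set G := invmx _; apply/colP => i; rewrite mxE.
have sG : G^T = G by rewrite trmx_inv metric_sym //; case: pW.
rewrite (_ : fhat F x W = 2^-1 *: (fun y => dot (G *m F y) (F y))); last first.
  by apply/funext => z; rewrite fhatE.
have H := is_derive_form y (delta_mx i 0) sG.
rewrite deriveZ //= derive_val.
rewrite scalerA mulVf ?pnatr_eq0 // scale1r mxE.
by apply: eq_bigr => j _; rewrite mulrC; congr (_ * _); rewrite [RHS]mxE.
Qed.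

(** The linear term contributes -gamma q, and the quadratic term gamma^-1 / 2 * gamma^2 q = gamma q
    / 2. *)
Lemma fhat_descent (S : 'M[R]_(p, tau)) W x gamma :
  nabla F x \in unitmx -> sym_posdef W -> gamma != 0 ->
  let y := snrvm_step F gamma (S, W) x in
  fhat F x W x + dot (grad (fhat F x W) x) (y - x)
    + gamma^-1 / 2 * wnorm2 W (y - x)
  = fhat F x W x - gamma / 2 * sketch_gain (nabla F x) W S (F x).
Proof.
move=> uN pW g0 y; have uW := sym_posdef_unit pW.
set N := nabla F x in uN *; set f := F x.
set u := Defs.pinv (S^T *m metric N W *m S) *m (S^T *m f).
have yE : y - x = - gamma *: (invmx W *m (N *m (S *m u))).
  rewrite /y /snrvm_step /= -/N -/f addrC addKr scaleNr /u /metric !mulmxA //.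
rewrite -addrA; congr (_ + _); rewrite grad_fhat // -/N -/f yE.
rewrite /wnorm2 -scalemxAr dotZr dotZl dotZr.
rewrite -metric_form //; last by case: pW.
rewrite -sketch_gain_solve //.
(* Since M^-1 = N^-1 W N^-T, the gradient is W N^-T f; then W cancels W^-1, N^-T cancels N, and <f,
   S u> remains. *)
have -> : dot (N *m (invmx (metric N W) *m f)) (invmx W *m (N *m (S *m u)))
    = sketch_gain N W S f.
  rewrite invmx_metric // -!mulmxA mulKVmx // dot_mulmx.
  case: pW => -> _; rewrite mulKVmx // dot_mulmx trmxK mulKmx //.
  by rewrite dotC dot_mulmx.
by field.
Qed.

End Descent.

(** * Integrals of almost surely simple functions *)

Section Integration.
Import HBNNSimple.
Local Open Scope ereal_scope.
Context d (T : measurableType d) {R : realType}.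

(** Both integrals are suprema over simple functions. One below f is almost everywhere below g; one
    below g restricted to the complement of N is below f, as f is nonnegative on N. *)
Lemma ge0_ae_eq_integral (mu : {measure set T -> \bar R})
    (f g : T -> \bar R) (N : set T) :
  (forall w, 0 <= f w) -> (forall w, 0 <= g w) ->
  measurable_fun setT g -> measurable N -> mu N = 0 ->
  (forall w, ~ N w -> f w = g w) -> \int[mu]_w f w = \int[mu]_w g w.
Proof.
move=> f0 g0 mg mN N0 fg; apply/le_anti/andP; split.
  rewrite [leLHS]ge0_integralTE //; apply: ge_ereal_sup => _ [h /= hf <-].
  rewrite -integralT_nnsfun; apply: ae_ge0_le_integral => //.
  - by move=> w _; rewrite lee_fin; exact: fun_ge0.
  - by apply/measurable_EFinP; exact: measurable_funP.
  - exists N; split=> // w /= /not_implyP[_ hg]; apply: contrapT => Nw.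
    by apply: hg; rewrite -(fg _ Nw).
have mgN : measurable_fun setT (g \_ (~` N)).
  apply/(measurable_restrictT _ _).1; first exact: measurableC.
  exact: measurable_funTS.
rewrite (@ae_eq_integral _ _ _ mu setT (g \_ (~` N))) //; last first.
  exists N; split=> // w /= /not_implyP[_ hg]; apply: contrapT => Nw.
  by apply: hg; rewrite patchE mem_set.
rewrite !ge0_integralTE //; last by move=> w; rewrite patchE; case: ifP.
apply: ge_ereal_sup => _ [h /= hg <-]; apply: ereal_sup_ubound.
exists h => // w /=; apply: le_trans (hg w) _; rewrite patchE.
by case: ifPn => // /set_mem /= /fg ->.
Qed.

(* Unlike [ae_eq_integral], f need not be measurable. *)
Lemma integral_eq_off_null (mu : {measure set T -> \bar R})
    (f g : T -> \bar R) (N : set T) :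
  measurable_fun setT g -> measurable N -> mu N = 0 ->
  (forall w, ~ N w -> f w = g w) -> \int[mu]_w f w = \int[mu]_w g w.
Proof.
move=> mg mN N0 fg; rewrite integralE [RHS]integralE; congr (_ - _).
all: apply: (ge0_ae_eq_integral (N := N)) => //.
- exact: measurable_funepos.
- by move=> w /fg; rewrite !funeposE => ->.
- exact: measurable_funeneg.
- by move=> w /fg; rewrite !funenegE => ->.
Qed.

(** * Finite families of disjoint events that cover all but a null set *)

Section Partition.
Variables (P : probability T R) (I : finType) (A : I -> set T).
Hypotheses (mA : forall i, measurable (A i)).
Hypothesis A_disj : forall i j w, A i w -> A j w -> i = j.
Hypothesis A_sum1 : \sum_i P (A i) = 1.

Lemma integral_indic_sum (c : I -> R) :
  \int[P]_w (\sum_i c i * \1_(A i) w)%:E = \sum_i (c i)%:E * P (A i).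
Proof.
transitivity (\int[P]_w (\sum_i (c i)%:E * (\1_(A i) w)%:E)).
  by apply: eq_integral => w _; rewrite -sumEFin; apply: eq_bigr.
rewrite integral_sum //; last first.
  by move=> i; apply: integrableZl => //; exact: integrable_indic.
apply: eq_bigr => i _.
rewrite integralZl //; last exact: integrable_indic.
by rewrite integral_indic // setIT.
Qed.

Lemma sum_indic (c : I -> R) i w : A i w -> (\sum_j c j * \1_(A j) w = c i)%R.
Proof.
move=> Aiw; rewrite (bigD1 i) //= indicE mem_set // mulr1 big1 ?addr0 // => j.
move=> /eqP ji; rewrite indicE memNset ?mulr0 // => Ajw.
exact: ji (A_disj Ajw Aiw).
Qed.

Lemma bigcup_partition_measurable : measurable (\bigcup_i A i).
Proof. by apply: fin_bigcup_measurable. Qed.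

(** By disjointness the indicator of the union is the sum of the indicators, whose integral is 1. *)
Lemma probability_partitionC : P (~` \bigcup_i A i) = 0.
Proof.
have mU := bigcup_partition_measurable.
rewrite probability_setC // -[X in P X]setIT -integral_indic //.
rewrite (_ : \int[P]_w _ = 1) ?subee //.
rewrite -A_sum1 -[RHS](eq_bigr _ (fun i _ => mul1e _)) -integral_indic_sum.
apply: eq_integral => w _; congr EFin.
have [[i _ Aiw]|Uw] := pselect ((\bigcup_i A i) w).
  by rewrite (sum_indic _ Aiw) indicE mem_set //; exists i.
rewrite indicE memNset // big1 // => i _.
by rewrite indicE memNset ?mulr0 // => Aiw; apply: Uw; exists i.
Qed.

Lemma expectation_partition (f : T -> R) (c : I -> R) :
  (forall i w, A i w -> f w = c i) ->
  'E_P[f] = (\sum_i fine (P (A i)) * c i)%:E.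
Proof.
move=> fc; rewrite unlock.
rewrite (@integral_eq_off_null P _
  (fun w => (\sum_i c i * \1_(A i) w)%:E) (~` \bigcup_i A i)).
- rewrite integral_indic_sum -sumEFin; apply: eq_bigr => i _.
  by rewrite muleC EFinM fineK // fin_num_measure.
- apply/measurable_EFinP; apply: measurable_sum => i.
  by apply: measurable_funM => //; exact: measurable_indic.
- exact/measurableC/bigcup_partition_measurable.
- exact: probability_partitionC.
- by move=> w /= /contrapT [i _ Aiw]; rewrite (fc _ _ Aiw) (sum_indic _ Aiw).
Qed.

End Partition.
End Integration.

(** * Finite histories *)

Section Sketches.
Context {R : realType} {p tau : nat}.
Implicit Type mu : probability (sketch R p tau) R.

Lemma sketch_measurable_set1 (z : sketch R p tau) : measurable [set z].
Proof.
have cz : closed [set z : ('M[R]_(p, tau) * 'M[R]_p)%type].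
  exact/accessible_closed_set1/hausdorff_accessible/norm_hausdorff.
rewrite -[X in measurable X]setCK; apply: measurableC.
by apply: sub_sigma_algebra; exact: closed_openC.
Qed.

(** The body of [proper_finite] with its witnesses exposed, so that they can be chosen as functions
    of x. *)
Definition atoms mu r (a : 'I_r -> R) (z : 'I_r -> sketch R p tau) :=
  [/\ injective z, (forall l, 0 < a l), \sum_l a l = 1
    & forall l, mu [set z l] = (a l)%:E].

Lemma atoms_supp mu r (a : 'I_r -> R) z l : atoms mu a z -> supp mu (z l).
Proof. by case=> _ a0 _ muz; rewrite /supp /= muz lte_fin. Qed.

Lemma expectation_atoms mu r (a : 'I_r -> R) z (f : sketch R p tau -> R) :
  atoms mu a z -> 'E_mu[f]%E = (\sum_l a l * f (z l))%:E.
Proof.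
case=> z_inj a0 a1 muz.
rewrite (@expectation_partition _ _ _ mu _ (fun l => [set z l])
  _ _ _ f (f \o z)).
- by congr EFin; apply: eq_bigr => l _; rewrite muz.
- by move=> l; exact: sketch_measurable_set1.
- by move=> i j w -> /z_inj.
- by under eq_bigr do rewrite muz; rewrite sumEFin a1.
- by move=> l w ->.
Qed.

Lemma mean_SST_atoms mu r (a : 'I_r -> R) z : atoms mu a z ->
  mean_SST mu = \sum_l a l *: ((z l).1 *m (z l).1^T).
Proof.
move=> az; apply/matrixP => i j; rewrite mxE (expectation_atoms _ az) /=.
by rewrite summxE; apply: eq_bigr => l _; rewrite !mxE.
Qed.

Lemma mean_SST_form mu r (a : 'I_r -> R) z (v : 'cV[R]_p) : atoms mu a z ->
  dot (mean_SST mu *m v) v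
  = \sum_l a l * dot ((z l).1^T *m v) ((z l).1^T *m v).
Proof.
move/mean_SST_atoms ->; rewrite mulmx_suml.
rewrite (big_morph (fun u => dot u v) (fun u w => dotDl u w v) (dot0l v)).
apply: eq_bigr => l _; rewrite -scalemxAl dotZl -mulmxA; congr (_ * _).
by rewrite dot_mulmx dotC dot_mulmx trmxK dotC.
Qed.

Lemma mean_SST_sym mu r (a : 'I_r -> R) z : atoms mu a z ->
  (mean_SST mu)^T = mean_SST mu.
Proof.
move/mean_SST_atoms ->; rewrite linear_sum; apply: eq_bigr => l _.
by rewrite linearZ /= trmx_mul trmxK.
Qed.

Lemma proper_finite_atoms mu : proper_finite mu ->
  {r : nat & {a : 'I_r -> R & {z | atoms mu a z}}}.
Proof. by case/cid => r /cid[a /cid[z az]]; exists r, a, z. Qed.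

End Sketches.

(** * The tree of histories of positive probability *)

Section Sampling.
Context {R : realType} {p tau : nat}.
Variables (F : 'cV[R]_p -> 'cV[R]_p) (gamma : R) (x0 : 'cV[R]_p).
Implicit Type h : nat -> sketch R p tau.

Lemma eq_snrvm h h' k : (forall j, (j < k)%N -> h j = h' j) ->
  snrvm F gamma x0 h k = snrvm F gamma x0 h' k.
Proof.
elim: k => //= k IH hh'; rewrite IH ?hh' // => j jk.
by apply: hh'; rewrite ltnS ltnW.
Qed.

Context d (T : measurableType d) (P : probability T R).
Variables (D : 'cV[R]_p -> probability (sketch R p tau) R).
Variable (SW : nat -> {mfun T >-> sketch R p tau}).
Hypothesis SW_law : snrvm_sampling P F D gamma x0 SW.
Variables (r : 'cV[R]_p -> nat) (a : forall x, 'I_(r x) -> R).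
Variable z : forall x, 'I_(r x) -> sketch R p tau.
Hypothesis D_atoms : forall x, atoms (D x) (@a x) (@z x).

Definition past k h : set T := [set w | forall j, (j < k)%N -> SW j w = h j].

Definition extend h k s : nat -> sketch R p tau :=
  fun j => if j == k then s else h j.

Lemma past_extend k h s :
  past k.+1 (extend h k s) = past k h `&` SW k @^-1` [set s].
Proof.
apply/seteqP; split=> w /=.
  move=> H; split; last by have := H k (ltnSn k); rewrite /extend eqxx.
  by move=> j jk; rewrite H ?ltnS 1?ltnW // /extend ltn_eqF.
move=> [H Hk] j; rewrite ltnS leq_eqVlt /extend; case: eqP => [-> //|_ /=].
exact: H.
Qed.

Lemma pastS k h : past k.+1 h = past k h `&` SW k @^-1` [set h k].
Proof.
rewrite -past_extend; apply/seteqP.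
by split=> w H j jk; rewrite H // /extend; case: eqP => [->|].
Qed.

Lemma past_measurable k h : measurable (past k h).
Proof.
elim: k => [|k IH].
  by rewrite (_ : past 0 h = setT) //; apply/seteqP; split.
rewrite pastS; apply: measurableI => //; rewrite -[X in measurable X]setTI.
by apply: (measurable_funP (SW k)) => //; exact: sketch_measurable_set1.
Qed.

Lemma past_extend_prob k h l (x := snrvm F gamma x0 h k) :
  P (past k.+1 (extend h k (z l))) = (P (past k h) * (@a x l)%:E)%E.
Proof.
rewrite past_extend; have [_ _ _ <-] := D_atoms x.
exact: (SW_law k h (sketch_measurable_set1 _)).
Qed.

Lemma past_supp k h : (0 < P (past k.+1 h))%E ->
  supp (D (snrvm F gamma x0 h k)) (h k).
Proof.
rewrite pastS (SW_law k h (sketch_measurable_set1 _)) -/(past k h).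
rewrite /supp /= => H; rewrite lt0e measure_ge0 andbT.
by apply: contraTN H => /eqP ->; rewrite mule0 ltxx.
Qed.

(** One level of the tree: its cells partition the sample space up to a null set. Having positive
    probability, each cell meets every almost sure event. *)
Definition history_tree k (I : finType) (h : I -> nat -> sketch R p tau) :=
  [/\ forall i, (0 < P (past k (h i)))%E,
      forall i j w, past k (h i) w -> past k (h j) w -> i = j
    & (\sum_i P (past k (h i)) = 1)%E].

(** Each history branches into the atoms of [D] at its own iterate. Their number depends on the
    iterate, hence the dependent sum as index type. *)
Lemma history_treeS k (I : finType) (h : I -> nat -> sketch R p tau)
    (x := fun i => snrvm F gamma x0 (h i) k) : history_tree k h ->
  history_tree k.+1 (fun q : {i : I & 'I_(r (x i))} =>
    extend (h (tag q)) k (z (tagged q))).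
Proof.
case=> h0 h_inj h1; split.
- move=> [i l] /=; rewrite past_extend_prob mule_gt0 // lte_fin.
  by have [_ a0 _ _] := D_atoms (x i).
- move=> [i l] [j m] w /=; rewrite !past_extend => -[iw lw] [jw mw].
  move: (h_inj _ _ _ iw jw) => ij; move: m mw; rewrite -ij => m mw.
  congr Tagged; have [z_inj _ _ _] := D_atoms (x i); apply: z_inj.
  by rewrite -lw -mw.
- under eq_bigr do rewrite past_extend_prob.
  rewrite -(sig_big_dep xpredT (fun _ => xpredT)
    (fun i (l : 'I_(r (x i))) => P (past k (h i)) * (a l)%:E)%E) -h1.
  apply: eq_bigr => i _; have [_ a0 a1 _] := D_atoms (x i).
  by rewrite -ge0_sume_distrr ?sumEFin ?a1 ?mule1 // => l _;
    rewrite lee_fin ltW.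
Qed.

Lemma history_tree_exists k :
  exists (I : finType) (hs : I -> nat -> sketch R p tau), history_tree k hs.
Proof.
elim: k => [|k [I [h hT]]]; last by do 2 eexists; exact: history_treeS hT.
(* Before any draw there is a single cell, the whole space; the history stored there is
   arbitrary. *)
exists unit, (fun _ => point).
have pE h : past 0 h = setT by apply/seteqP; split.
split=> [i|[] [] //|]; first by rewrite pE probability_setT lte_fin.
under eq_bigr do rewrite pE probability_setT.
by rewrite sumEFin sumr_const card_unit.
Qed.

(** Dependence on the first k draws alone; it stands in for measurability with respect to them. *)
Definition adapted k (f : T -> R) :=
  forall w w', (forall j, (j < k)%N -> SW j w = SW j w') -> f w = f w'.

Lemma expectation_tree k (I : finType) (hs : I -> nat -> sketch R p tau)
    (om : I -> T) (f : T -> R) :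
  history_tree k hs -> (forall i, past k (hs i) (om i)) -> adapted k f ->
  'E_P[f]%E = (\sum_i fine (P (past k (hs i))) * f (om i))%:E.
Proof.
case=> h0 h_inj h1 hom fk; apply: expectation_partition => //.
  by move=> i; exact: past_measurable.
by move=> i w iw; apply: fk => j jk; rewrite iw // hom.
Qed.

(** Off the null complement of the cells of level k + 1, the run follows a history of positive
    probability, to which [past_supp] applies; countably many k are then combined. *)
Lemma ae_supp :
  {ae P, forall w k, supp (D (snrvm F gamma x0 (fun j => SW j w) k)) (SW k w)}.
Proof.
apply: (@ae_foralln _ _ _ P) => k.
have [I [h [h0 h_inj h1]]] := history_tree_exists k.+1.
exists (~` \bigcup_i past k.+1 (h i)); split.
- apply: measurableC; apply: fin_bigcup_measurable => // i _.
  exact: past_measurable.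
- by apply: probability_partitionC => // i; exact: past_measurable.
- move=> w /= nsupp [i _ iw]; apply: nsupp; rewrite iw //.
  rewrite (@eq_snrvm _ (h i)); first exact: past_supp.
  by move=> j jk; rewrite iw // ltnS ltnW.
Qed.

Lemma ae_past_witness (G : set T) k h : {ae P, forall w, G w} ->
  (0 < P (past k h))%E -> exists2 w, past k h w & G w.
Proof.
move=> [N [mN N0 GN]] p0; apply: contrapT => nw.
suff : (P (past k h) <= P N)%E by rewrite N0 leNgt p0.
apply: le_measure; rewrite ?inE //; first exact: past_measurable.
by move=> w hw; apply: GN => /= Gw; apply: nw; exists w.
Qed.

Lemma tree_witness (G : set T) k (I : finType)
    (hs : I -> nat -> sketch R p tau) :
  {ae P, forall w, G w} -> history_tree k hs ->
  {om : I -> T | forall i, past k (hs i) (om i) /\ G (om i)}.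
Proof.
move=> GP [h0 _ _]; have w i := cid2 (ae_past_witness GP (h0 i)).
by exists (fun i => s2val (w i)) => i; split; [exact: s2valP|exact: s2valP'].
Qed.

(** The weights and sample points are fixed before f, and the points lie in G: inequalities valid on
    G pass to expectations term by term, without measurability. *)
Lemma expectation_adapted (G : set T) k : {ae P, forall w, G w} ->
  exists (I : finType) (q : I -> R) (om : I -> T),
    [/\ forall i, 0 < q i, forall i, G (om i)
      & forall f, adapted k f -> 'E_P[f]%E = (\sum_i q i * f (om i))%:E].
Proof.
move=> GP; have [I [h hT]] := history_tree_exists k.
have [om homG] := tree_witness GP hT.
exists I, (fun i => fine (P (past k (h i)))), om; split.
- move=> i; apply: fine_gt0; have [h0 _ _] := hT; rewrite h0 /=.
  by rewrite ltey_eq fin_num_measure //; exact: past_measurable.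
- by move=> i; have [] := homG i.
- by move=> f; apply: (expectation_tree hT) => i; have [] := homG i.
Qed.

(** The tower property: condition on the first k draws, then average over the next one. *)
Lemma expectation_draw (G : set T) k (X : T -> 'cV[R]_p) :
  {ae P, forall w, G w} ->
  (forall w, X w = snrvm F gamma x0 (fun j => SW j w) k) ->
  exists (I : finType) (q : I -> R) (om : I -> T),
    [/\ forall i, 0 < q i, forall i, G (om i)
      & forall g, 'E_P[fun w => g (X w) (SW k w)]%E
        = (\sum_i q i * \sum_l a l * g (X (om i)) (@z (X (om i)) l))%:E].
Proof.
move=> GP XE; have [I [h hT]] := history_tree_exists k.
have [om homG] := tree_witness GP hT.
(* The sum is computed with representatives [omS] of level k + 1 and stated with [om] of level k;
   the iterate [X] is the same at both. *)
have hTS := history_treeS hT; have [omS homS] := tree_witness GP hTS.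
exists I, (fun i => fine (P (past k (h i)))), om; split.
- move=> i; apply: fine_gt0; have [h0 _ _] := hT; rewrite h0 /=.
  by rewrite ltey_eq fin_num_measure //; exact: past_measurable.
- by move=> i; have [] := homG i.
move=> g; rewrite (expectation_tree hTS (fun q => (homS q).1)); last first.
  move=> w w' ww'; rewrite !XE (@eq_snrvm _ (fun j => SW j w')) ?ww' // => j jk.
  by rewrite ww' // ltnS ltnW.
congr EFin.
have Xom i : X (om i) = snrvm F gamma x0 (h i) k.
  by rewrite XE; apply: eq_snrvm => j jk; have [-> ] := homG i.
transitivity (\sum_i fine (P (past k (h i))) * \sum_l
  a l * g (snrvm F gamma x0 (h i) k) (@z (snrvm F gamma x0 (h i) k) l)).
  rewrite [RHS](eq_bigr _ (fun i _ => mulr_sumr _ _ _ _)).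
  rewrite (sig_big_dep xpredT (fun _ => xpredT)) /=.
  apply: eq_bigr => -[i l] _ /=; have [hS _] := homS (Tagged _ l).
  rewrite past_extend_prob fineM ?fin_num_measure //=;
    last exact: past_measurable.
  rewrite -mulrA; congr (_ * (_ * g _ _)).
  - rewrite XE; apply: eq_snrvm => j jk.
    by rewrite hS ?ltnS 1?ltnW //= /extend ltn_eqF.
  - by rewrite hS //= /extend eqxx.
by apply: eq_bigr => i _; rewrite Xom.
Qed.

End Sampling.

(** * Contraction *)

Section OneStep.
Context {R : realType} {p tau : nat}.

Lemma sketch_step_contraction (F : 'cV[R]_p -> 'cV[R]_p) (x : 'cV[R]_p)
    (mW LW mS LS mF LF gamma : R) r (a : 'I_r -> R) (z : 'I_r -> sketch R p tau)
    (rho := mF ^+ 2 / LF ^+ 2 * (mW / LW) * (mS / LS)) :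
  0 < mW -> 0 < LW -> 0 < mS -> 0 < LS -> 0 < mF -> 0 < LF -> 0 < gamma ->
  nabla F x \in unitmx ->
  (forall l, 0 < a l) -> \sum_l a l = 1 -> (forall l, sym_posdef (z l).2) ->
  (forall l v, mW * dot v v <= dot ((z l).2 *m v) v <= LW * dot v v) ->
  (forall v, mF ^+ 2 * dot v v
    <= dot ((nabla F x)^T *m v) ((nabla F x)^T *m v) <= LF ^+ 2 * dot v v) ->
  (forall l v, dot ((z l).1 *m (z l).1^T *m v) v <= LS * dot v v) ->
  mS * dot (F x) (F x)
    <= \sum_l a l * dot ((z l).1^T *m F x) ((z l).1^T *m F x) ->
  \sum_l a l * (fhat F x (z l).2 x
                - gamma / 2 * sketch_gain (nabla F x) (z l).2 (z l).1 (F x))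
  <= (1 - gamma * rho) * \sum_l a l * fhat F x (z l).2 x.
Proof.
move=> mW0 LW0 mS0 LS0 mF0 LF0 g0 uN a0 a1 pW bW bN bS bmean.
set f := F x in bmean *.
pose gain l := sketch_gain (nabla F x) (z l).2 (z l).1 f.
set Sphi := \sum_l a l * fhat F x _ x; pose Sgain := \sum_l a l * gain l.
have -> : \sum_l a l * (fhat F x (z l).2 x - gamma / 2 * gain l)
    = Sphi - gamma / 2 * Sgain.
  rewrite /Sgain mulr_sumr -sumrB; apply: eq_bigr => l _.
  by rewrite mulrBr (mulrCA (a l) (gamma / 2)).
have gain_lb : mS * dot f f <= LS * (LF ^+ 2 / mW) * Sgain.
  apply: le_trans bmean _; rewrite /Sgain mulr_sumr; apply: ler_sum => l _.
  rewrite (mulrCA _ (a l)); apply: ler_wpM2l; first exact: ltW.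
  apply: sketch_gain_lb => //; [exact: ltW|].
  by move=> v; apply: (metric_norm_ub mW0 (pW l) (bW l) bN).
have phi_ub : Sphi <= 2^-1 * (LW / mF ^+ 2) * dot f f.
  (* The weights sum to 1, so the constant [B] is its own average and the bound is termwise. *)
  set B := 2^-1 * _ * _; rewrite -[B]mul1r -a1 mulr_suml /B.
  apply: ler_sum => l _.
  rewrite ler_wpM2l ?(ltW (a0 l)) // fhatE // -mulrA ler_wpM2l ?invr_ge0 //.
  exact: (invmetric_ub LW0 mF0 (pW l) uN (bW l) bN).
have rho0 : 0 < rho by rewrite /rho !mulr_gt0 ?invr_gt0 ?exprn_gt0.
(* The claim is this inequality multiplied by gamma. *)
suff H : rho * Sphi <= 2^-1 * Sgain by nra.
apply: (le_trans (y := rho * (2^-1 * (LW / mF ^+ 2) * dot f f))).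
  by rewrite ler_wpM2l // ltW.
(* rho is the constant for which rho LW / mF^2 = mW mS / (LF^2 LS), joining [phi_ub] to
   [gain_lb]. *)
have -> : rho * (2^-1 * (LW / mF ^+ 2) * dot f f)
    = 2^-1 * (mW / (LF ^+ 2 * LS) * (mS * dot f f)).
  by rewrite /rho; field; rewrite !gt_eqF.
rewrite ler_wpM2l ?invr_ge0 //.
have -> : Sgain = mW / (LF ^+ 2 * LS) * (LS * (LF ^+ 2 / mW) * Sgain).
  by field; rewrite !gt_eqF.
by rewrite ler_wpM2l // ltW // divr_gt0 // mulr_gt0 // exprn_gt0.
Qed.

(* c may be negative, but then all the u k vanish. *)
Lemma geometric_decay (u : nat -> R) (c : R) :
  (forall k, 0 <= u k) -> (forall k, u k.+1 <= c * u k) ->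
  forall k, u k <= u 0%N * c ^+ k.
Proof.
move=> u0 uc; have [c0|c0] := leP 0 c.
  elim=> [|k IH]; first by rewrite mulr1.
  by apply: le_trans (uc k) _; rewrite exprS mulrCA ler_wpM2l.
have u_eq0 k : u k = 0 by have := u0 k; have := uc k; have := u0 k.+1; nra.
by move=> k; rewrite !u_eq0 mul0r.
Qed.

End OneStep.

Theorem theorem4p7 (R : realType) (p tau : nat)
    (F : 'cV[R]_p -> 'cV[R]_p) (F_C1 : C1 F) (F_inj : injective F)
    (D : 'cV[R]_p -> probability (sketch R p tau) R)
    (D_finite : forall x, proper_finite (D x))
    (nabla_unit : forall x, (nabla F x)^T *m nabla F x \in unitmx)
    (mean_unit : forall x, mean_SST (D x) \in unitmx)
    (W_posdef : forall x SW, supp (D x) SW -> sym_posdef SW.2)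
    (Omega : set 'cV[R]_p) (mu_W L_W mu_S L_S mu_F L_F : R)
    (mu_W_gt0 : 0 < mu_W) (L_W_gt0 : 0 < L_W)
    (mu_S_gt0 : 0 < mu_S) (L_S_gt0 : 0 < L_S)
    (mu_F_gt0 : 0 < mu_F) (L_F_gt0 : 0 < L_F)
    (bounds : forall x SW, Omega x -> supp (D x) SW ->
       [/\ spec SW.2 `<=` `[mu_W, L_W]%classic,
           singvals (nabla F x) `<=` `[mu_F, L_F]%classic,
           mu_S <= lambda_min (mean_SST (D x))
         & opnorm (SW.1 *m SW.1^T) <= L_S])
    (gamma : R) (gamma_gt0 : 0 < gamma) (x0 : 'cV[R]_p)
    (d : measure_display) (T : measurableType d) (P : probability T R)
    (SW : nat -> {mfun T >-> sketch R p tau})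
    (SW_law : snrvm_sampling P F D gamma x0 SW)
    (X : nat -> T -> 'cV[R]_p)
    (X_run : forall k w, X k w = snrvm F gamma x0 (fun j => SW j w) k)
    (L : R) (L_gt0 : 0 < L)
    (relative_smoothness : forall w, (forall k, supp (D (X k w)) (SW k w)) ->
       forall (k : nat) (x : 'cV[R]_p),
       fhat F (X k.+1 w) (SW k.+1 w).2 x
         <= fhat F (X k w) (SW k w).2 (X k w)
            + dot (grad (fhat F (X k w) (SW k w).2) (X k w)) (x - X k w)
            + L / 2 * wnorm2 (SW k w).2 (x - X k w))
    (gammaE : gamma = 1 / L)
    (X_Omega : {ae P, forall w, forall k, Omega (X k w)}) :
  let rho := mu_F ^+ 2 / L_F ^+ 2 * (mu_W / L_W) * (mu_S / L_S) in
  let C := (2%:E * 'E_P[fun w => fhat F (X 0%N w) (SW 0%N w).2 (X 0%N w)]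
            * (L_F ^+ 2 / mu_W)%:E)%E in
  forall k : nat,
    ('E_P[fun w => (enorm (F (X k w)) ^+ 2)%R]
       <= C * ((1 - gamma * rho) ^+ k)%:E)%E.
Proof.
move=> rho C k; have [F_diff _] := F_C1.
have uN x : nabla F x \in unitmx.
  by have := nabla_unit x; rewrite unitmx_mul => /andP[].
pose at_ x := proper_finite_atoms (D_finite x).
pose r x := projT1 (at_ x); pose a x : 'I_(r x) -> R := projT1 (projT2 (at_ x)).
pose z x : 'I_(r x) -> sketch R p tau := sval (projT2 (projT2 (at_ x))).
have D_atoms x : atoms (D x) (@a x) (@z x) := svalP (projT2 (projT2 (at_ x))).
(* The almost sure event on which the smoothness assumption may be invoked and the spectral bounds
   hold at every step. *)
pose G := [set w | (forall k, supp (D (X k w)) (SW k w))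
                   /\ forall k, Omega (X k w)].
have GP : {ae P, forall w, G w}.
  apply: filterS2 X_Omega (ae_supp SW_law D_atoms) => w wO wS.
  by split=> // j; rewrite X_run.
have W_bounds x s : Omega x -> supp (D x) s ->
    forall v, mu_W * dot v v <= dot (s.2 *m v) v <= L_W * dot v v.
  move=> Ox xs; have [sW _] := W_posdef _ _ xs; apply: spec_bounds => //.
  by have [] := bounds _ _ Ox xs.
have N_bounds x s : Omega x -> supp (D x) s -> forall v, mu_F ^+ 2 * dot v v
    <= dot ((nabla F x)^T *m v) ((nabla F x)^T *m v) <= L_F ^+ 2 * dot v v.
  move=> Ox xs; apply: nabla_tr_bounds => //; apply: singvals_bounds => //.
  by have [] := bounds _ _ Ox xs.
have S_bounds x s : Omega x -> supp (D x) s ->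
    forall v, dot (s.1 *m s.1^T *m v) v <= L_S * dot v v.
  move=> Ox xs v; have [_ _ _ SLS] := bounds _ _ Ox xs.
  by apply: le_trans (opnorm_form _ _) _; rewrite ler_wpM2r ?dot_ge0.
pose phi k w := fhat F (X k w) (SW k w).2 (X k w).
(* The value of the quadratic model at the next iterate, by [fhat_descent]. *)
pose psi k w := phi k w - gamma / 2
  * sketch_gain (nabla F (X k w)) (SW k w).2 (SW k w).1 (F (X k w)).
have X_adapted m w w' : (forall j, (j < m)%N -> SW j w = SW j w') ->
    X m w = X m w' by rewrite !X_run; exact: eq_snrvm.
have X_adaptedS m w w' : (forall j, (j < m.+1)%N -> SW j w = SW j w') ->
    X m w = X m w'.
  by move=> ww'; apply: X_adapted => j jm; apply: ww'; rewrite ltnS ltnW.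
have phi_adapted m : adapted SW m.+1 (phi m).
  by move=> w w' ww'; rewrite /phi (X_adaptedS _ _ _ ww') ww'.
(* One draw more than [psi m] depends on, so that it is compared with [phi m.+1] over the same
   cells. *)
have psi_adapted m : adapted SW m.+2 (psi m).
  move=> w w' ww'; have {}ww' j : (j < m.+1)%N -> SW j w = SW j w'.
    by move=> jm; apply: ww'; rewrite ltnS ltnW.
  by rewrite /psi (phi_adapted _ _ _ ww') (X_adaptedS _ _ _ ww') ww'.
have psi_le m w : G w -> phi m.+1 w <= psi m w.
  move=> [wS _]; have XS : X m.+1 w
      = snrvm_step F gamma ((SW m w).1, (SW m w).2) (X m w).
    by rewrite !X_run /=; case: (SW m w).
  have := relative_smoothness w wS m (X m.+1 w).
  have -> : L = gamma^-1 by rewrite gammaE div1r invrK.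
  rewrite XS (fhat_descent F_diff _ (uN _) (W_posdef _ _ (wS m))) ?lt0r_neq0 //.
  by rewrite -XS.
have phi_lb m w : G w ->
    dot (F (X m w)) (F (X m w)) <= 2 * (L_F ^+ 2 / mu_W) * phi m w.
  move=> [wS wO]; have pW := W_posdef _ _ (wS m).
  rewrite /phi fhatE //.
  have := invmetric_lb mu_W_gt0 pW (uN _) (W_bounds _ _ (wO m) (wS m))
    (N_bounds _ _ (wO m) (wS m)) (F (X m w)).
  lra.
have phi_ge0 m w : G w -> 0 <= phi m w.
  move=> Gw; have := phi_lb m w Gw; have := dot_ge0 (F (X m w)) => f0 fphi.
  rewrite -(pmulr_rge0 _ (_ : 0 < 2 * (L_F ^+ 2 / mu_W))).
    exact: le_trans fphi.
  by rewrite mulr_gt0 // divr_gt0 // exprn_gt0.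
pose A k := fine ('E_P[phi k])%E.
(* The expectation is finite, so [fine] loses nothing. *)
have EA m : ('E_P[phi m] = (A m)%:E)%E.
  have [I [q [om [_ _ Eq]]]] := expectation_adapted SW_law D_atoms m.+1 GP.
  by rewrite /A Eq.
have A_ge0 m : 0 <= A m.
  have [I [q [om [q0 omG Eq]]]] := expectation_adapted SW_law D_atoms m.+1 GP.
  rewrite /A Eq //; apply: sumr_ge0 => i _.
  by rewrite mulr_ge0 ?phi_ge0 // ltW.
have A_step m : A m.+1 <= (1 - gamma * rho) * A m.
  have le_psi : A m.+1 <= fine ('E_P[psi m])%E.
    have [I [q [om [q0 omG Eq]]]] := expectation_adapted SW_law D_atoms m.+2 GP.
    rewrite /A !Eq //=; apply: ler_sum => i _.
    by rewrite ler_wpM2l ?psi_le // ltW.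
  apply: le_trans le_psi _.
  (* [psi m] and [phi m] are functions of [X m] and [SW m], so it suffices to average over the atoms
     of [D x] at each fixed iterate x. *)
  have [I [q [om [q0 omG Eq]]]] :=
    expectation_draw SW_law D_atoms GP (X_run m).
  rewrite (Eq (fun x s => fhat F x s.2 x - gamma / 2
    * sketch_gain (nabla F x) s.2 s.1 (F x))).
  rewrite /A (Eq (fun x s => fhat F x s.2 x)).
  rewrite /= mulr_sumr; apply: ler_sum => i _.
  rewrite [leRHS]mulrCA ler_wpM2l ?(ltW (q0 i)) //.
  have [omS omO] := omG i; set x := X m (om i).
  have at_x := D_atoms x; have [_ a0 a1 _] := at_x.
  have zS l : supp (D x) (z x l) := atoms_supp l at_x.
  apply: sketch_step_contraction => //.
  - by move=> l; exact: (W_posdef x _ (zS l)).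
  - by move=> l; exact: (W_bounds x _ (omO m) (zS l)).
  (* The bounds are assumed along some pair in the support; the pair drawn at [om i] provides
     one. *)
  - exact: (N_bounds x _ (omO m) (omS m)).
  - by move=> l; exact: (S_bounds x _ (omO m) (zS l)).
  - rewrite -(mean_SST_form _ at_x).
    apply: le_trans (lambda_min_form (mean_SST_sym at_x) _).
    rewrite ler_wpM2r ?dot_ge0 //.
    by have [_ _ + _] := bounds _ _ (omO m) (omS m).
have F_le : ('E_P[fun w => (enorm (F (X k w)) ^+ 2)%R]
    <= (2 * (L_F ^+ 2 / mu_W) * A k)%:E)%E.
  (* Level k + 1 although F(x^k) needs only k draws: [phi k] also involves the metric drawn at step
     k. *)
  have [I [q [om [q0 omG Eq]]]] := expectation_adapted SW_law D_atoms k.+1 GP.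
  rewrite /A !Eq //=; last first.
    by move=> w w' ww'; rewrite (X_adaptedS _ _ _ ww').
  rewrite lee_fin mulr_sumr; apply: ler_sum => i _.
  by rewrite enorm_sqr [leRHS]mulrCA ler_wpM2l ?phi_lb // ltW.
apply: le_trans F_le _; rewrite /C (EA 0%N) -!EFinM lee_fin.
set lam := L_F ^+ 2 / mu_W; have lam0 : 0 < lam by rewrite divr_gt0 ?exprn_gt0.
have -> : 2 * A 0%N * lam * (1 - gamma * rho) ^+ k
    = 2 * lam * (A 0%N * (1 - gamma * rho) ^+ k) by ring.
by rewrite ler_wpM2l ?geometric_decay // ltW // mulr_gt0.
Qed.
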